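(* Given $d\ge 2$ and $0<\varepsilon<1$, there exists $\gamma=\Omega\left(\dfrac{1}{d\log d}\cdot\dfrac{\varepsilon^2}{\log^2(1/\varepsilon)}\right)$ such that the following holds for any field $\mathbb{F}$ and any $M_1,\dots,M_k\in\mathbb{F}^{d\times d}$ with $k>1/\gamma$. Let $M=\bigotimes_{i=1}^kM_i$ and $n=d^k$. Then $R^{rc}_{\mathbb{F}}(M,n^{1-\gamma})\le n^{\varepsilon}$, and so $R_{\mathbb{F}}(M,n^{1-\gamma})\le n^{1+\varepsilon}$.
   Context: For $A\in\mathbb{F}^{n\times n}$ and a target rank $r$: the rigidity $R_{\mathbb{F}}(A,r)$ is the minimum number of non-zero entries of $Z\in\mathbb{F}^{n\times n}$ with $\operatorname{rank}(A-Z)\le r$; the row-column rigidity $R^{rc}_{\mathbb{F}}(A,r)$ is the minimal $t$ for which there exists $Z$ with $\operatorname{rank}(A-Z)\le r$ and every row and every column of $Z$ having at most $t$ non-zero entries. $\bigotimes$ is the Kronecker product; $\Omega$ hides an absolute constant.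
   Formalization: The factor ε²/log²(1/ε) in the bound for γ is replaced by min(1, ε²/log²(1/ε)), since it is unbounded as ε→1 and would force γ>1, where the claim fails for all-ones matrices; nothing changes for ε ≤ 1/2. *)

(* Defs.v *)
From HB Require Import structures.
From mathcomp Require Import all_boot all_order all_algebra.
From mathcomp Require Import mxtens.
From mathcomp Require Import boolp reals exp.

Set Implicit Arguments.
Unset Strict Implicit.
Unset Printing Implicit Defensive.

Import Order.TTheory GRing.Theory Num.Theory.
Local Open Scope ring_scope.

Section Rigidity.
Variables (F : fieldType) (n : nat).
Implicit Types (A Z : 'M[F]_n) (r t : nat).

Definition nnz Z : nat := #|[set ij : 'I_n * 'I_n | Z ij.1 ij.2 != 0]|.

Definition rc_sparse t Z : Prop :=
  (forall i, #|[set j | (Z i j != 0)%R]| <= t)%N /\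
  (forall j, #|[set i | (Z i j != 0)%R]| <= t)%N.

Definition rigid_pred A r : pred nat :=
  fun s => `[< exists Z, (\rank (A - Z)%R <= r)%N /\ nnz Z = s >].

Definition rc_rigid_pred A r : pred nat :=
  fun t => `[< exists Z, (\rank (A - Z)%R <= r)%N /\ rc_sparse t Z >].

Lemma rigid_pred_ex A r : exists s, rigid_pred A r s.
Proof. by exists (nnz A); apply/asboolP; exists A; rewrite subrr mxrank0. Qed.

Lemma rc_rigid_pred_ex A r : exists t, rc_rigid_pred A r t.
Proof.
exists n; apply/asboolP; exists A; rewrite subrr mxrank0; split=> //.
by split=> i; rewrite -[X in (_ <= X)%N]card_ord max_card.
Qed.

Definition rigidity A r : nat := ex_minn (rigid_pred_ex A r).

Definition rc_rigidity A r : nat := ex_minn (rc_rigid_pred_ex A r).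

End Rigidity.

(* [kronmx M] is M_0 *t (M_1 *t ( .. *t 1)); the cast only identifies          *)
(* d * d ^ k with d ^ k.+1.                                                    *)
Fixpoint kronmx (F : fieldType) (d k : nat) :
    ('I_k -> 'M[F]_d) -> 'M[F]_(d ^ k) :=
  match k return ('I_k -> 'M[F]_d) -> 'M[F]_(d ^ k) with
  | 0 => fun _ => 1%:M
  | k'.+1 => fun M =>
      castmx (esym (expnS d k'), esym (expnS d k'))
        (M ord0 *t kronmx (fun i : 'I_k' => M (lift ord0 i)))
  end.

(* The order of magnitude of gamma, up to an absolute constant factor. The     *)
(* factor eps^2 / ln^2 (1 / eps) is unbounded as eps --> 1, whereas no         *)
(* gamma > 1 is possible (the target rank would be 0); it is therefore capped  *)
(* at 1, which changes nothing for eps <= 1/2.                                 *)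
Definition gamma_order (R : realType) (d : nat) (eps : R) : R :=
  1 / (d%:R * ln d%:R) * Num.min 1 (eps ^+ 2 / ln (1 / eps) ^+ 2).

(* Main.v *)
(* By LUP decomposition each block M_i is a product of a permutation matrix    *)
(* and 2d matrices equal to the identity except in one column p, so M is a     *)
(* product of a permutation matrix and 2d Kronecker products A of such         *)
(* one-column matrices with the same p. Index rows and columns of A by words   *)
(* of length k over d letters. If A x y != 0, then y agrees with x except at   *)
(* positions where y has the letter p and x does not. By Chernoff, all but a   *)
(* fraction exp (- Omega (e^2 d k)) of the words have (1/d +- e) k letters p.  *)
(* Rows with too few and columns with too many letters p go into the low-rank  *)
(* part; on the other ones A x y != 0 forces x and y to be at Hamming distance *)
(* at most 2 e k, which bounds the row and column sparsity. In a product of    *)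
(* approximations ranks add up and sparsities multiply, and                    *)
(* e ~ eps / (d log (1/eps)) balances the two.                                 *)
Require Import Defs.
From HB Require Import structures.
From mathcomp Require Import all_boot all_order all_algebra.
From mathcomp Require Import fingroup perm mxtens ring lra.
From mathcomp Require Import boolp reals sequences exp.

Set Implicit Arguments.
Unset Strict Implicit.
Unset Printing Implicit Defensive.

Import Order.TTheory GRing.Theory Num.Theory.
Local Open Scope ring_scope.

(** Quantitatively, put q = [rate eps] and e = q / (512 d). Since approximations multiply
    ([rc_approxM]), [kronmx_approx] reduces the problem to Kronecker products of one-column
    matrices. For these, [with_cols_rc_approx] gives rank 2 d^k exp(- e^2 d k / 8) and sparsity
    exp(2 e k (ln (d / 2e) + 1)): at a nonzero entry, passing from the row word to the column word
    can only turn letters into p, so the Hamming distance is the gain in letters p, small when both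
    counts are typical.

    All 2d factors together have rank at most n^(1 - gamma) by [gamma_tail_le] and sparsity at most
    n^eps by [sparsity_exponent_le]. The rank wants e large, the sparsity wants it small: the latter
    asks for q (ln (1/q) + ln d) = O(eps ln d), which q = min(1, eps / ln (1/eps)) achieves. *)

(** * Calculus of rank-plus-sparse approximations *)

Definition rc_approx (F : fieldType) (n : nat) (A : 'M[F]_n) (r t : nat) :=
  exists Z : 'M[F]_n, (\rank (A - Z)%R <= r)%N /\ rc_sparse t Z.

Lemma rc_sparseM (F : fieldType) (n s t : nat) (A B : 'M[F]_n) :
  rc_sparse s A -> rc_sparse t B -> rc_sparse (s * t) (A *m B).
Proof.
have bigcup_bound (I J : finType) (D : {set I}) (G : I -> {set J}) a b :
    (#|D| <= a)%N -> (forall i, (#|G i| <= b)%N) ->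
    (#|\bigcup_(i in D) G i| <= a * b)%N.
  move=> Da Gb; apply: leq_trans (leq_mul Da (leqnn b)).
  rewrite -sum_nat_const.
  elim/big_rec2: _ => [|i m H _ le_Hm]; first by rewrite cards0.
  by rewrite (leq_trans (leq_card_setU _ _)) // leq_add.
have mul_neq0 i j : (A *m B) i j != 0 -> exists2 l, A i l != 0 & B l j != 0.
  rewrite mxE => nz.
  have [l /andP[Ail Blj]|none] := pickP (fun l => (A i l != 0) && (B l j != 0)).
    by exists l.
  case/eqP: nz; apply: big1 => l _; apply/eqP; rewrite mulf_eq0.
  by rewrite -[_ || _]negbK negb_or none.
move=> [Ar Ac] [Br Bc]; split=> [i|j].
  apply: leq_trans (bigcup_bound _ _ _ _ _ _ (Ar i) Br).
  apply/subset_leq_card/subsetP=> j; rewrite inE => /mul_neq0[l Ail Blj].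
  by apply/bigcupP; exists l; rewrite inE.
rewrite mulnC; apply: leq_trans (bigcup_bound _ _ _ _ _ _ (Bc j) Ac).
apply/subset_leq_card/subsetP=> i; rewrite inE => /mul_neq0[l Ail Blj].
by apply/bigcupP; exists l; rewrite inE.
Qed.

(** The error telescopes: each of its two terms contains one of the low-rank errors [A - Y], [B - Z]
    as a factor. *)
Lemma rc_approxM (F : fieldType) (n r s t u : nat) (A B : 'M[F]_n) :
  rc_approx A r s -> rc_approx B t u -> rc_approx (A *m B) (r + t) (s * u).
Proof.
move=> [Y [rY sY]] [Z [rZ sZ]]; exists (Y *m Z); split; last exact: rc_sparseM.
have -> : A *m B - Y *m Z = (A - Y) *m B + Y *m (B - Z).
  by rewrite mulmxBl mulmxBr addrA subrK.
apply: leq_trans (mxrank_add _ _) _.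
apply: leq_add; [apply: leq_trans rY | apply: leq_trans rZ].
  exact: mxrankM_maxl.
exact: mxrankM_maxr.
Qed.

Lemma rc_sparse_approx (F : fieldType) (n t : nat) (A : 'M[F]_n) :
  rc_sparse t A -> rc_approx A 0 t.
Proof. by move=> sA; exists A; rewrite subrr mxrank0. Qed.

Lemma perm_mx_rc_sparse (F : fieldType) (n : nat) (s : 'S_n) :
  rc_sparse 1 (perm_mx s : 'M[F]_n).
Proof.
have nz a b : ((perm_mx s : 'M[F]_n) a b != 0) = (s a == b).
  by rewrite !mxE; case: (s a == b); rewrite ?eqxx ?oner_eq0.
split=> a; apply/card_le1_eqP=> b c; rewrite !inE !nz => /eqP eb /eqP ec.
  by rewrite -eb -ec.
by apply: (@perm_inj _ s); rewrite eb ec.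
Qed.

Lemma mxrank_row_support (F : fieldType) (m n : nat) (A : 'M[F]_(m, n))
    (B : {set 'I_m}) :
  (forall i j, i \notin B -> A i j = 0) -> (\rank A <= #|B|)%N.
Proof.
move=> A0; have -> : A = \sum_(i in B) delta_mx i i *m A.
  apply/matrixP=> i j; rewrite summxE.
  have entry l : (delta_mx l l *m A) i j = (i == l)%:R * A l j.
    rewrite mxE (bigD1 l) //= big1 => [|h /negPf hl]; last first.
      by rewrite mxE hl andbF mul0r.
    by rewrite mxE eqxx andbT addr0.
  rewrite (eq_bigr _ (fun l _ => entry l)); have [iB|iB] := boolP (i \in B).
    rewrite (bigD1 i) //= eqxx mul1r big1 ?addr0 // => l /andP[_ /negPf li].
    by rewrite eq_sym li mul0r.
  rewrite A0 // big1 // => l lB; case: eqP => [il|]; last by rewrite mul0r.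
  by rewrite il lB in iB.
rewrite -sum1_card; elim/big_rec2: _ => [|i s C _ le_Cs]; first by rewrite mxrank0.
apply: leq_trans (mxrank_add _ _) _; rewrite leq_add //.
by rewrite (leq_trans (mxrankM_maxl _ _)) // mxrank_delta.
Qed.

Lemma mxrank_rc_support (F : fieldType) (m n : nat) (A : 'M[F]_(m, n))
    (B : {set 'I_m}) (C : {set 'I_n}) :
  (forall i j, i \notin B -> j \notin C -> A i j = 0) ->
  (\rank A <= #|B| + #|C|)%N.
Proof.
move=> A0; pose A1 := \matrix_(i, j) (if i \in B then A i j else 0).
have -> : A = A1 + (A - A1) by rewrite addrC subrK.
apply: leq_trans (mxrank_add _ _) _; apply: leq_add.
  by apply: mxrank_row_support => i j /negPf iB; rewrite mxE iB.
rewrite -mxrank_tr; apply: mxrank_row_support => j i jC; rewrite !mxE.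
by case: ifPn => [_|iB]; [rewrite subrr | rewrite subr0 A0].
Qed.

(** * Kronecker products entrywise, with indices read as words over d letters *)

Section Digits.
Variables (F : fieldType) (d : nat).

Fixpoint digits (k : nat) : 'I_(d ^ k) -> {ffun 'I_k -> 'I_d} :=
  match k return 'I_(d ^ k) -> {ffun 'I_k -> 'I_d} with
  | 0 => fun _ => [ffun i : 'I_0 => False_rect _ (notF (ltn_ord i))]
  | k'.+1 => fun x =>
      let ab := mxtens_unindex (cast_ord (expnS d k') x) in
      [ffun i => if unlift ord0 i is Some i' then digits ab.2 i' else ab.1]
  end.

Lemma digits_ord0 k (x : 'I_(d ^ k.+1)) :
  digits x ord0 = (mxtens_unindex (cast_ord (expnS d k) x)).1.
Proof. by rewrite ffunE unlift_none. Qed.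

Lemma digits_lift k (x : 'I_(d ^ k.+1)) i :
  digits x (lift ord0 i) = digits (mxtens_unindex (cast_ord (expnS d k) x)).2 i.
Proof. by rewrite ffunE liftK. Qed.

Lemma digits_inj k : injective (@digits k).
Proof.
elim: k => [|k IHk] x y.
  by move=> _; rewrite (ord1 (x : 'I_1)) (ord1 (y : 'I_1)).
move=> eq_xy; apply: (@cast_ord_inj _ _ (expnS d k)).
apply: (can_inj (@mxtens_unindexK _ _)).
apply/pair_eqP/andP; split; apply/eqP; first by rewrite -!digits_ord0 eq_xy.
by apply: IHk; apply/ffunP=> i; rewrite -!digits_lift eq_xy.
Qed.

Lemma kronmxE k (M : 'I_k -> 'M[F]_d) x y :
  kronmx M x y = \prod_i M i (digits x i) (digits y i).
Proof.
elim: k M x y => [|k IHk] M x y.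
  rewrite big_ord0 mxE; suff -> : x = y by rewrite eqxx.
  by rewrite (ord1 (x : 'I_1)) (ord1 (y : 'I_1)).
rewrite big_ord_recl !digits_ord0 [LHS]castmxE mxE IHk /= !esymK.
by congr (_ * _); apply: eq_bigr => i _; rewrite !digits_lift.
Qed.

Lemma kronmx_ext k (M N : 'I_k -> 'M[F]_d) : M =1 N -> kronmx M = kronmx N.
Proof.
move=> eqMN; apply/matrixP=> x y; rewrite !kronmxE.
by apply: eq_bigr => i _; rewrite eqMN.
Qed.

Lemma kronmx_mul k (M N : 'I_k -> 'M[F]_d) :
  kronmx (fun i => M i *m N i) = kronmx M *m kronmx N.
Proof.
elim: k M N => [|k IHk] M N /=; first by rewrite mul1mx.
rewrite (IHk (fun i => M (lift ord0 i)) (fun i => N (lift ord0 i))) -tensmx_mul.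
by case: _ / (esym (expnS d k)).
Qed.

Lemma kronmx_rc_sparse1 k (M : 'I_k -> 'M[F]_d) :
  (forall i, rc_sparse 1 (M i)) -> rc_sparse 1 (kronmx M).
Proof.
move=> sM; split=> [x|y].
  apply/card_le1_eqP=> y z; rewrite !inE !kronmxE => /prodf_neq0 yM /prodf_neq0 zM.
  apply: digits_inj; apply/ffunP=> i.
  have /card_le1_eqP := (sM i).1 (digits x i).
  by apply; rewrite inE; [apply: yM | apply: zM].
apply/card_le1_eqP=> x z; rewrite !inE !kronmxE => /prodf_neq0 xM /prodf_neq0 zM.
apply: digits_inj; apply/ffunP=> i.
have /card_le1_eqP := (sM i).2 (digits y i).
by apply; rewrite inE; [apply: xM | apply: zM].
Qed.

End Digits.

(** * Factoring triangular matrices, then all matrices, into one-column matrices *)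

Section Columns.
Variables (F : fieldType) (d : nat).
Implicit Types (T : 'M[F]_d) (s : seq 'I_d) (p : 'I_d).

(** Interpolates between the identity ([s] empty) and [T] ([s] full), as the partial products of the
    column factorization do. *)
Definition with_cols T s : 'M[F]_d :=
  \matrix_(i, j) (if j \in s then T i j else (i == j)%:R).

Lemma with_cols_nil T : with_cols T [::] = 1%:M.
Proof. by apply/matrixP=> i j; rewrite !mxE. Qed.

Lemma with_cols_full T s : s =i 'I_d -> with_cols T s = T.
Proof. by move=> s_full; apply/matrixP=> i j; rewrite mxE s_full. Qed.

(** The right factor changes column p only, into the image of column p of [T] under [with_cols T s].
    That column vanishes on [s], and [with_cols T s] fixes the basis vectors outside [s], so it is
    left intact. *)
Lemma with_cols_rcons T s p : p \notin s -> {in s, forall i, T i p = 0} ->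
  with_cols T (rcons s p) = with_cols T s *m with_cols T [:: p].
Proof.
move=> ps T0; apply/matrixP=> i j; rewrite !mxE mem_rcons inE.
have [->|jp] /= := eqVneq j p; last first.
  rewrite (bigD1 j) //= big1 => [|h hj]; last first.
    by rewrite !mxE inE (negPf jp) (negPf hj) mulr0.
  by rewrite !mxE inE (negPf jp) eqxx mulr1 addr0.
under eq_bigr do rewrite !mxE inE eqxx.
have [is_|is_] := boolP (i \in s).
  rewrite T0 //; symmetry; apply: big1 => h _; case: ifPn => hs.
    by rewrite T0 // mulr0.
  by case: eqP => [ih|_]; [rewrite -ih is_ in hs | rewrite mul0r].
rewrite (bigD1 i) //= (negPf is_) eqxx mul1r big1 ?addr0 // => h hi.
by case: ifPn => hs; [rewrite T0 // mulr0 | rewrite eq_sym (negPf hi) mul0r].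
Qed.

End Columns.

(** The same column p is split off in all k blocks at once, so the mixed product rule yields one
    Kronecker factor per column. The condition along [s] covers lower triangular matrices
    (increasing [s]) and upper triangular ones (decreasing [s]). *)
Lemma kronmx_triangular_approx (F : fieldType) (d k r t : nat)
    (T : 'I_k -> 'M[F]_d) (s : seq 'I_d) :
  (forall (N : 'I_k -> 'M[F]_d) p,
     rc_approx (kronmx (fun i => with_cols (N i) [:: p])) r t) ->
  uniq s -> (forall i, pairwise (fun a b => T i a b == 0) s) ->
  rc_approx (kronmx (fun i => with_cols (T i) s)) (size s * r) (t ^ size s).
Proof.
move=> ap1; elim/last_ind: s => [|s p IHs].
  move=> _ _; apply: rc_sparse_approx.
  apply: kronmx_rc_sparse1 => i; rewrite with_cols_nil -perm_mx1.
  exact: perm_mx_rc_sparse.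
rewrite rcons_uniq => /andP[ps us] tri.
have split_s i : with_cols (T i) (rcons s p) =
    with_cols (T i) s *m with_cols (T i) [:: p].
  apply: with_cols_rcons ps _ => a sa.
  by have := tri i; rewrite pairwise_rcons => /andP[/allP/(_ a sa)/eqP].
rewrite (kronmx_ext split_s) kronmx_mul size_rcons mulSnr expnSr.
apply: rc_approxM (ap1 T p); apply: IHs us _ => i.
by have := tri i; rewrite pairwise_rcons => /andP[].
Qed.

Lemma kronmx_approx (F : fieldType) (d k r t : nat) (M : 'I_k -> 'M[F]_d.+1) :
  (forall (N : 'I_k -> 'M[F]_d.+1) p,
     rc_approx (kronmx (fun i => with_cols (N i) [:: p])) r t) ->
  rc_approx (kronmx M) (2 * d.+1 * r) (t ^ (2 * d.+1)).
Proof.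
move=> ap1; pose lup i := cormen_lup (M i).
pose P i := (lup i).1.1; pose L i := (lup i).1.2; pose U i := (lup i).2.
have eM i : M i = (P i)^T *m ((with_cols (L i) (enum 'I_d.+1)) *m
                     (with_cols (U i) (rev (enum 'I_d.+1)))).
  rewrite !with_cols_full; try by move=> a; rewrite ?mem_rev mem_enum.
  have := cormen_lup_correct (M i); rewrite /P /L /U /lup.
  have := cormen_lup_perm (M i).
  case: (cormen_lup (M i)) => [[P' L'] U'] /= /is_perm_mxP[s ->] /esym eLU.
  rewrite [L' *m U']eLU.
  by rewrite tr_perm_mx mulmxA -perm_mxM mulVg perm_mx1 mul1mx.
rewrite (kronmx_ext eM) !kronmx_mul.
have -> : (2 * d.+1 * r = 0 + (d.+1 * r + d.+1 * r))%N.
  by rewrite add0n -mulnDl mul2n addnn.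
have -> : (t ^ (2 * d.+1) = 1 * (t ^ d.+1 * t ^ d.+1))%N.
  by rewrite mul1n -expnD mul2n addnn.
have sorted_enum : sorted (fun a b : 'I_d.+1 => (a < b)%N) (enum 'I_d.+1).
  by have := iota_ltn_sorted 0 d.+1; rewrite -val_enum_ord sorted_map.
have lt_enum : pairwise (fun a b : 'I_d.+1 => (a < b)%N) (enum 'I_d.+1).
  by rewrite -sorted_pairwise // => ? ? ?; apply: ltn_trans.
(* Columns of [U] are split off in decreasing order, so that the required zeros are those below the
   diagonal. *)
have gt_enum : pairwise (fun a b : 'I_d.+1 => (b < a)%N) (rev (enum 'I_d.+1)).
  rewrite -sorted_pairwise ?rev_sorted // => b a c ba cb.
  exact: ltn_trans cb ba.
apply: rc_approxM; [|apply: rc_approxM].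
- apply: rc_sparse_approx; apply: kronmx_rc_sparse1 => i.
  rewrite /P /lup; have /is_perm_mxP[s ->] := cormen_lup_perm (M i).
  by rewrite tr_perm_mx; apply: perm_mx_rc_sparse.
- have := @kronmx_triangular_approx _ _ _ _ _ L _ ap1 (enum_uniq 'I_d.+1).
  rewrite size_enum_ord; apply=> i; apply: sub_pairwise lt_enum => a b ab.
  by rewrite /L cormen_lup_lower 1?ltnW // (ltn_eqF ab : (a == b) = false).
- have := @kronmx_triangular_approx _ _ _ _ _ U (rev (enum 'I_d.+1)) ap1.
  rewrite rev_uniq enum_uniq size_rev size_enum_ord; apply=> // i.
  apply: sub_pairwise gt_enum => a b ab.
  by rewrite /U /= cormen_lup_upper.
Qed.

(** * Counting words by exponential moments *)

(** Markov's inequality for the exponential of the sum; summed over all words, this exponential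
    factors over the positions. *)
Lemma exp_markov_card (R : realType) (I J : finType) (c : I -> J -> R) (t : R) :
  (#|[set f : {ffun I -> J} | (t <= \sum_i c i (f i))%R]|)%:R <=
    expR (- t) * \prod_i \sum_j expR (c i j).
Proof.
rewrite bigA_distr_bigA mulr_sumr -sum1_card natr_sum.
rewrite [leRHS](bigID (mem [set f : {ffun I -> J} | t <= \sum_i c i (f i)])) /=.
rewrite ler_wpDr //.
  by apply: sumr_ge0 => f _; rewrite mulr_ge0 ?expR_ge0 // prodr_ge0 // => i _;
    rewrite expR_ge0.
apply: ler_sum => f; rewrite inE => tf.
by rewrite -expR_sum -expRD -[1]expR0 ler_expR addrC subr_ge0.
Qed.

(** From exp x <= 1 / (1 - x) and (1 - x)(1 + x + 2x^2) = 1 + x^2 (1 - 2x) >= 1. *)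
Lemma expR_le_quadratic (R : realType) (x : R) :
  `|x| <= 2^-1 -> expR x <= 1 + x + 2 * x ^+ 2.
Proof.
rewrite ler_norml => /andP[x_ge x_le].
have x1 : 0 < 1 - x by lra.
have : expR x <= (1 - x)^-1.
  by rewrite -[x in expR x]opprK expRN lef_pV2 ?posrE ?expR_gt0 // expR_ge1Dx.
move=> /le_trans; apply; rewrite -[_^-1]mul1r ler_pdivrMr //.
by nra.
Qed.

Section Counting.
Variables (R : realType) (d k : nat).
Implicit Types (p : 'I_d) (x y : {ffun 'I_k -> 'I_d}).

Definition occ p x := #|[set i | x i == p]|.
Definition hamming x y := #|[set i | x i != y i]|.

Lemma occE p x : (occ p x)%:R = \sum_i (x i == p)%:R :> R.
Proof.
rewrite /occ -sum1_card natr_sum big_mkcond /=.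
by apply: eq_bigr => i _; rewrite inE; case: ifP.
Qed.

Lemma hammingE x y : (hamming x y)%:R = \sum_i (x i != y i)%:R :> R.
Proof.
rewrite /hamming -sum1_card natr_sum big_mkcond /=.
by apply: eq_bigr => i _; rewrite inE; case: ifP.
Qed.

(** Both tails at once: positive s bounds the words with many letters p, negative s those with
    few. *)
Lemma card_occ_tail p (s t : R) : `|s| <= 2^-1 ->
  (#|[set x | (t <= s * (occ p x)%:R)%R]|)%:R <=
    d%:R ^+ k * expR (k%:R * ((s + 2 * s ^+ 2) / d%:R) - t).
Proof.
move=> s_small; have d_gt0 : 0 < d%:R :> R.
  by rewrite ltr0n (leq_ltn_trans _ (ltn_ord p)).
have := @exp_markov_card R 'I_k 'I_d (fun _ j => s * (j == p)%:R) t.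
under eq_finset => x do rewrite -mulr_sumr -occE.
move=> /le_trans; apply; rewrite prodr_const card_ord.
rewrite expRD mulrCA mulrC mulrA ler_wpM2r ?expR_ge0 //.
rewrite expRM_natl -exprMn lerXn2r ?nnegrE //.
- by apply: sumr_ge0 => j _; rewrite expR_ge0.
- by rewrite mulr_ge0 ?expR_ge0 // ltW.
have -> : \sum_j expR (s * (j == p)%:R) = d%:R + (expR s - 1).
  transitivity (\sum_j (1 + (if j == p then expR s - 1 else 0))).
    apply: eq_bigr => j _; case: eqP => _; first by rewrite mulr1 addrC subrK.
    by rewrite mulr0 expR0 addr0.
  by rewrite big_split /= sumr_const card_ord -big_mkcond big_pred1_eq.
apply: (@le_trans _ _ (d%:R * (1 + (s + 2 * s ^+ 2) / d%:R))); last first.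
  by rewrite [leRHS]mulrC ler_wpM2l ?expR_ge1Dx // ltW.
rewrite mulrDr mulr1 mulrCA divff ?gt_eqF // mulr1 lerD2l.
by have := expR_le_quadratic s_small; lra.
Qed.

(** Each mismatch is weighted by exp(- m) = b / d, so every position contributes at most 1 + b <=
    exp b; no binomial coefficients are needed. *)
Lemma card_hamming_ball x (b : R) : 0 < b <= 1 -> (0 < d)%N ->
  (#|[set y | ((hamming x y)%:R <= b * k%:R)%R]|)%:R <=
    expR (b * k%:R * (ln (d%:R / b) + 1)).
Proof.
move=> /andP[b_gt0 b_le1] d_gt0; set m := ln (d%:R / b).
have d_ge1 : 1 <= d%:R :> R by rewrite ler1n.
have db : 0 < d%:R / b by rewrite divr_gt0 // ltr0n.
have m_ge0 : 0 <= m by rewrite ln_ge0 // ler_pdivlMr // mul1r; lra.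
have := @exp_markov_card R 'I_k 'I_d (fun i j => - m * (x i != j)%:R)
  (- m * (b * k%:R)).
under eq_finset => y do rewrite -mulr_sumr -hammingE.
move=> markov; apply: le_trans (le_trans markov _).
  rewrite ler_nat; apply/subset_leq_card/subsetP=> y; rewrite !inE => xy.
  by rewrite !mulNr lerN2 ler_wpM2l.
rewrite -mulNr opprK mulrDr mulr1 expRD [m * _]mulrC ler_wpM2l ?expR_ge0 //.
rewrite expRM_natr -[k in leRHS]card_ord -prodr_const.
apply: ler_prod => i _; apply/andP; split.
  by apply: sumr_ge0 => j _; rewrite expR_ge0.
apply: le_trans (expR_ge1Dx b).
apply: (@le_trans _ _ (\sum_j ((if j == x i then 1 else 0) + b / d%:R))).
  apply: ler_sum => j _; rewrite eq_sym; case: eqP => _.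
    by rewrite mulr0 expR0 lerDl divr_ge0 // ltW.
  by rewrite mulr1 expRN lnK // invf_div add0r.
rewrite big_split /= -big_mkcond big_pred1_eq sumr_const card_ord.
by rewrite -[b / _ *+ _]mulr_natr divfK // pnatr_eq0 -lt0n.
Qed.

End Counting.

Lemma with_cols_rc_approx (R : realType) (F : fieldType) (d k : nat) (e : R)
    (N : 'I_k -> 'M[F]_d) (p : 'I_d) :
  0 < e -> e * d%:R <= 2 -> 2 * e <= 1 ->
  rc_approx (kronmx (fun i => with_cols (N i) [:: p]))
    (Num.truncn (2 * (d%:R ^+ k * expR (- (e ^+ 2 * d%:R * k%:R / 8)))))
    (Num.truncn (expR (2 * e * k%:R * (ln (d%:R / (2 * e)) + 1)))).
Proof.
move=> e_gt0 ed_le2 e_le; set A := kronmx _.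
have d_gt0 : (0 < d)%N by rewrite (leq_ltn_trans _ (ltn_ord p)).
have dR_gt0 : 0 < d%:R :> R by rewrite ltr0n.
pose lo : R := (d%:R^-1 - e) * k%:R; pose hi : R := (d%:R^-1 + e) * k%:R.
pose B := [set x : 'I_(d ^ k) | (occ p (digits x))%:R < lo].
pose C := [set y : 'I_(d ^ k) | hi < (occ p (digits y))%:R].
pose Z := \matrix_(x, y) (if (x \in B) || (y \in C) then 0 else A x y).
have ball x y : Z x y != 0 ->
    (hamming (digits x) (digits y))%:R <= 2 * e * k%:R :> R.
  rewrite mxE; case: ifPn; first by rewrite eqxx.
  rewrite negb_or !inE -!leNgt => /andP[lo_x hi_y]; rewrite kronmxE => /prodf_neq0 nz.
  (* Outside column p the block is the identity. *)
  have nzi i : (digits y i == p) || (digits x i == digits y i).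
    have := nz i isT; rewrite mxE inE; case: ifP => //= _.
    by case: (digits x i == _); rewrite ?eqxx.
  suff : hamming (digits x) (digits y) = (occ p (digits y) - occ p (digits x))%N
         /\ (occ p (digits x) <= occ p (digits y))%N.
    by case=> -> le_xy; rewrite natrB // /lo /hi in lo_x hi_y *; lra.
  have sub : [set i | digits x i == p] \subset [set i | digits y i == p].
    apply/subsetP=> i; rewrite !inE => /eqP xi; have := nzi i.
    by rewrite xi [p == _]eq_sym orbb.
  split; last exact: subset_leq_card.
  rewrite /occ -cardsDS //; apply: eq_card => i; rewrite !inE.
  have := nzi i; have [->|yp] := eqVneq (digits y i) p; first by rewrite andbT.
  by move=> /eqP ->; rewrite eqxx andbF.
have image_le (P : pred {ffun 'I_k -> 'I_d}) (D : {set 'I_(d ^ k)}) (b : R) :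
    #|[set f | P f]|%:R <= b -> {in D, forall x, P (digits x)} -> #|D|%:R <= b.
  move=> Pb DP; apply: le_trans Pb.
  rewrite ler_nat -(card_imset _ (@digits_inj d k)).
  by apply/subset_leq_card/subsetP=> _ /imsetP[x xD ->]; rewrite inE DP.
exists Z; split; last first.
  have hammingC f g : hamming f g = hamming g f :> nat.
    by apply: eq_card => i; rewrite !inE eq_sym.
  split=> z; rewrite truncn_ge_nat ?expR_ge0 //;
    apply: image_le (card_hamming_ball (digits z) _ d_gt0) _;
    rewrite ?e_le ?mulr_gt0 // => w; rewrite inE => /ball //.
  by rewrite hammingC.
apply: leq_trans (mxrank_rc_support (B := B) (C := C) _) _.
  move=> x y xB yC; rewrite !mxE (negPf xB) (negPf yC) subrr //.
rewrite truncn_ge_nat; last by rewrite !mulr_ge0 ?expR_ge0 ?exprn_ge0.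
(* This s minimizes the exponent 2 s^2 / d - s e per letter; e d <= 2 keeps it within the range of
   the quadratic bound. *)
pose s : R := e * d%:R / 4.
have s_gt0 : 0 < s by rewrite /s divr_gt0 ?mulr_gt0.
have s_small : `|s| <= 2^-1 by rewrite gtr0_norm // /s; lra.
have expo : k%:R * (2 * s ^+ 2 / d%:R) - s * e * k%:R = - (e ^+ 2 * d%:R * k%:R / 8).
  by rewrite /s; field; rewrite gt_eqF.
rewrite natrD mulr_natl mulr2n lerD //.
  have s_small' : `|- s| <= 2^-1 by rewrite normrN.
  apply: image_le (le_trans (card_occ_tail k p (- s * lo) s_small') _) _ => [|x].
    rewrite -expo ler_wpM2l ?exprn_ge0 // ler_expR sqrrN /lo.
    by rewrite le_eqVlt; apply/orP; left; apply/eqP; field; rewrite gt_eqF.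
  by rewrite inE !mulNr lerN2 => /ltW; rewrite ler_pM2l.
apply: image_le (le_trans (card_occ_tail k p (s * hi) s_small) _) _ => [|x].
  rewrite -expo ler_wpM2l ?exprn_ge0 // ler_expR /hi.
  by rewrite le_eqVlt; apply/orP; left; apply/eqP; field; rewrite gt_eqF.
by rewrite inE => /ltW; rewrite ler_pM2l.
Qed.

(** * From approximations to rigidity *)

Lemma rc_approx_rc_rigidity (F : fieldType) (n r t : nat) (A : 'M[F]_n) :
  rc_approx A r t -> (rc_rigidity A r <= t)%N.
Proof.
by move=> apA; rewrite /rc_rigidity; case: ex_minnP => s _; apply; apply/asboolP.
Qed.

Lemma rc_approx_weaken (F : fieldType) (n r s t : nat) (A : 'M[F]_n) :
  (r <= s)%N -> rc_approx A r t -> rc_approx A s t.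
Proof. by move=> rs [Z [rZ sZ]]; exists Z; rewrite (leq_trans rZ rs). Qed.

Lemma rc_approx_rigidity (F : fieldType) (n r t : nat) (A : 'M[F]_n) :
  rc_approx A r t -> (rigidity A r <= n * t)%N.
Proof.
move=> [Z [rZ [sZ _]]].
apply: (@leq_trans (nnz Z)).
  rewrite /rigidity; case: ex_minnP => s _; apply.
  by apply/asboolP; exists Z.
rewrite /nnz -sum1_card big_mkcond /=.
rewrite (eq_bigr (fun ij : 'I_n * 'I_n => (Z ij.1 ij.2 != 0)%R : nat)); last first.
  by move=> ij _; rewrite inE; case: ifP.
rewrite -(pair_bigA _ (fun i j => (Z i j != 0)%R : nat)) /=.
apply: (@leq_trans (\sum_(i < n) t)); last by rewrite sum_nat_const card_ord.
apply: leq_sum => i _; apply: leq_trans (sZ i).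
rewrite -sum1_card [leqRHS]big_mkcond /=; apply: leq_sum => j _.
by rewrite inE; case: ifP.
Qed.

(** * Choice of parameters *)

Section GammaOrder.
Variable R : realType.
Implicit Types e : R.

(** Square root of the capped eps-factor of [gamma_order], see [rateX2]. *)
Definition rate e : R := Num.min 1 (e / ln (1 / e)).

Lemma ln_inv_ge e : 0 < e -> 1 - e <= ln (1 / e).
Proof.
move=> e_gt0; rewrite div1r lnV ?posrE //.
have : ln (1 + (e - 1)) <= e - 1 by apply: le_ln1Dx; lra.
by rewrite [1 + _]addrC subrK; lra.
Qed.

Lemma rateX2 e : 0 < e < 1 -> rate e ^+ 2 = Num.min 1 (e ^+ 2 / ln (1 / e) ^+ 2).
Proof.
move=> /andP[e_gt0 e_lt1]; have L_gt0 : 0 < ln (1 / e).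
  by have := ln_inv_ge e_gt0; lra.
rewrite /rate -expr_div_n; have f_gt0 : 0 < e / ln (1 / e) by rewrite divr_gt0.
have [f_le1|f_gt1] := leP 1 (e / ln (1 / e)).
  by rewrite expr1n min_l // expr_ge1 // ltW.
by rewrite min_r // expr_le1 // ltW.
Qed.

Lemma rate_gt0 e : 0 < e < 1 -> 0 < rate e.
Proof.
move=> /andP[e_gt0 e_lt1]; rewrite /rate lt_min ltr01 divr_gt0 //.
by have := ln_inv_ge e_gt0; lra.
Qed.

Lemma rate_le1 e : rate e <= 1.
Proof. by rewrite /rate ge_min lexx. Qed.

Lemma rate_le e : 0 < e < 1 -> rate e <= 2 * e.
Proof.
move=> /andP[e_gt0 e_lt1]; have [e_le|e_gt] := leP (2 * e) 1; last first.
  by apply: le_trans (rate_le1 e) (ltW e_gt).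
rewrite /rate ge_min; apply/orP; right.
have L_ge := ln_inv_ge e_gt0; rewrite ler_pdivrMr; last by lra.
by nra.
Qed.

(** With L = ln (1/e), the uncapped rate is e / L and its - ln is L + ln L <= 2 L: dividing by L is
    what cancels the logarithm. *)
Lemma rate_entropy_le e : 0 < e < 1 -> rate e * - ln (rate e) <= 2 * e.
Proof.
move=> /andP[e_gt0 e_lt1]; have L_ge := ln_inv_ge e_gt0.
have L_gt0 : 0 < ln (1 / e) by lra.
rewrite /rate; case: (leP 1 (e / ln (1 / e))) => _.
  by rewrite ln1 oppr0 mulr0; lra.
rewrite ln_div ?posrE // opprB; have := ln_sublinear L_gt0.
have -> : ln e = - ln (1 / e) by rewrite div1r lnV ?posrE // opprK.
move: L_gt0; set L := ln (1 / e); move=> L_gt0 lnL.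
by rewrite mulrAC ler_pdivrMr //; nra.
Qed.

Lemma ln_nat_ge d : (2 <= d)%N -> 2^-1 <= ln d%:R :> R.
Proof.
move=> d_ge2; apply: (@le_trans _ _ (ln 2)); last first.
  by rewrite ler_ln ?posrE ?ltr0n ?ler_nat // ltnW.
by have := @ln_inv_ge 2^-1; rewrite div1r invrK => /(_ _); lra.
Qed.

End GammaOrder.

Section Tradeoff.
Variables (R : realType) (d : nat) (eps : R).
Hypotheses (d_ge2 : (2 <= d)%N) (eps01 : 0 < eps < 1).

(* A row (column) of the Kronecker product is exceptional when the frequency   *)
(* of the pivot digit in its index falls short of (exceeds) 1 / d by more than  *)
(* this.                                                                        *)
Definition deviation : R := rate eps / (512 * d%:R).

Let d_gt0 : 0 < d%:R :> R. Proof. by rewrite ltr0n ltnW. Qed.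

(** Per letter, the exponent of the product of the 2d sparsities is q (2 ln d + 8 ln 2 + 1 - ln q) /
    128; both q and - q ln q are at most 2 eps. *)
Lemma sparsity_exponent_le :
  2 * d%:R * (2 * deviation * (ln (d%:R / (2 * deviation)) + 1)) <=
  eps * ln d%:R.
Proof.
have q_gt0 := rate_gt0 eps01; have q_le := rate_le eps01.
have ent := rate_entropy_le eps01; have l_ge := ln_nat_ge R d_ge2.
have -> : 2 * deviation = rate eps / 256 / d%:R.
  by rewrite /deviation; field; rewrite gt_eqF.
have -> : d%:R / (rate eps / 256 / d%:R) = d%:R * d%:R * 2 ^+ 8 / rate eps.
  by field; rewrite !gt_eqF.
have ln2_le : ln (2 : R) <= 1 by have := @le_ln1Dx R 1; apply; lra.
rewrite ln_div ?posrE ?mulr_gt0 ?exprn_gt0 //.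
rewrite lnM ?posrE ?mulr_gt0 ?exprn_gt0 // lnXn // lnM ?posrE //.
move: q_gt0 q_le ent l_ge ln2_le d_gt0.
case/andP: eps01; move: (rate eps) (ln d%:R) (ln 2) (ln _) => q l m u.
move=> e_gt0 e_lt1 q_gt0 q_le ent l_ge m_le dp.
have -> : 2 * d%:R * (q / 256 / d%:R * (l + l + m *+ 8 - u + 1)) =
   (q * (2 * l + 8 * m + 1) + q * - u) / 128 by field; rewrite gt_eqF.
have : q * (2 * l + 8 * m + 1) <= q * (2 * l + 9) by apply: ler_wpM2l; lra.
have : q * (2 * l + 9) <= 2 * eps * (2 * l + 9) by apply: ler_wpM2r; lra.
(* As ln d >= 1/2, constant multiples of eps are absorbed into eps ln d. *)
have : eps <= eps * (2 * l) by apply: ler_peMr; lra.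
by move: ent; lra.
Qed.

Lemma gamma_tail_le (gamma : R) (k : nat) :
  gamma = 2 ^- 23 * gamma_order d eps -> 1 / gamma < k%:R ->
  2 * d%:R * (2 * (d%:R ^+ k * expR (- (deviation ^+ 2 * d%:R * k%:R / 8)))) <=
  d%:R ^+ k * expR (- (gamma * k%:R * ln d%:R)).
Proof.
move=> eg; have q_gt0 := rate_gt0 eps01; have l_ge := ln_nat_ge R d_ge2.
have l_gt0 : 0 < ln d%:R :> R by lra.
have {}eg : gamma = 2 ^- 23 * (rate eps ^+ 2 / (d%:R * ln d%:R)).
  by rewrite eg /gamma_order -rateX2 // mul1r [_ * rate eps ^+ 2]mulrC.
have g_gt0 : 0 < gamma by rewrite eg !(mulr_gt0, exprn_gt0, invr_gt0).
rewrite ltr_pdivrMr // => gk.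
(* Both sides are q^2 k / (2^21 d); this fixes the constant 2^-23. *)
have -> : deviation ^+ 2 * d%:R * k%:R / 8 = 4 * (gamma * k%:R * ln d%:R).
  by rewrite eg /deviation; field; rewrite !gt_eqF.
have gkl : ln d%:R <= gamma * k%:R * ln d%:R.
  by rewrite ler_peMl ?ltW // mulrC.
set g := gamma * k%:R * ln d%:R in gkl *.
(* Since gamma k > 1, the surplus 3 g is at least 3 ln d and pays for the prefactor 4 d <= d^3. *)
have -> : - g = 3 * g - 4 * g by ring.
rewrite expRD -!mulrA [leLHS]mulrA mulrA [leLHS]mulrCA mulrA.
rewrite -[leLHS]mulrA ler_wpM2l ?exprn_ge0 // ler_wpM2r ?expR_ge0 //.
apply: (@le_trans _ _ (expR (3 * ln d%:R))); last by rewrite ler_expR; lra.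
rewrite expRM_natl lnK ?posrE //.
have : 2 <= d%:R :> R by rewrite ler_nat.
by move: (d%:R : R) => x x_ge2; nra.
Qed.

End Tradeoff.

Theorem theorem4p2 (R : realType) :
  exists2 c : R, 0 < c &
  forall (d : nat) (eps : R), (2 <= d)%N -> 0 < eps < 1 ->
  exists2 gamma : R, c * gamma_order d eps <= gamma &
  forall (F : fieldType) (k : nat) (M : 'I_k -> 'M[F]_d),
    1 / gamma < k%:R ->
    let n : R := (d ^ k)%:R in
    let r : nat := Num.truncn (n `^ (1 - gamma)) in
    (rc_rigidity (kronmx M) r)%:R <= n `^ eps /\
    (rigidity (kronmx M) r)%:R <= n `^ (1 + eps).
Proof.
exists (2 ^- 23); first by rewrite invr_gt0 exprn_gt0.
case=> [//|d] eps d_ge2 eps01; set gamma := 2 ^- 23 * _.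
exists gamma => // F k M k_gt n r.
have d_gt0 : 0 < d.+1%:R :> R by [].
have nE : n = d.+1%:R ^+ k by rewrite /n natrX.
have n_gt0 : 0 < n by rewrite nE exprn_gt0.
have powE (x : R) : n `^ x = expR (x * (k%:R * ln d.+1%:R)).
  by rewrite /powR gt_eqF // nE lnXn // mulr_natl.
have q_gt0 := rate_gt0 eps01; have q_le1 := rate_le1 eps.
set e := deviation d.+1 eps.
have e_gt0 : 0 < e by rewrite divr_gt0 // mulr_gt0.
have ed : e * d.+1%:R = rate eps / 512.
  by rewrite /e /deviation invfM mulrA divfK ?gt_eqF.
have e_le : e <= e * d.+1%:R by rewrite ler_peMr ?(ltW e_gt0) // ler1n.
pose t := Num.truncn (expR (2 * e * k%:R * (ln (d.+1%:R / (2 * e)) + 1))).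
have ap : rc_approx (kronmx M) r (t ^ (2 * d.+1)).
  apply: rc_approx_weaken (kronmx_approx (r := Num.truncn (2 * (d.+1%:R ^+ k *
    expR (- (e ^+ 2 * d.+1%:R * k%:R / 8))))) (t := t) M _); last first.
    by move=> N p; apply: with_cols_rc_approx => //; lra.
  rewrite /r truncn_ge_nat ?powR_ge0 // natrM.
  apply: (@le_trans _ _ (2 * d.+1%:R * (2 * (d.+1%:R ^+ k *
    expR (- (e ^+ 2 * d.+1%:R * k%:R / 8)))))).
    rewrite natrM ler_wpM2l ?mulr_ge0 // truncn_le.
    by rewrite !mulr_ge0 ?exprn_ge0 ?expR_ge0.
  apply: le_trans (gamma_tail_le d_ge2 eps01 (erefl gamma) k_gt) _.
  rewrite powE mulrBl mul1r expRD expRM_natl lnK ?posrE //.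
  by rewrite mulrA.
have t_le : (t ^ (2 * d.+1))%:R <= n `^ eps.
  rewrite natrX powE; apply: (@le_trans _ _
    (expR (2 * e * k%:R * (ln (d.+1%:R / (2 * e)) + 1)) ^+ (2 * d.+1))).
    by rewrite lerXn2r ?nnegrE ?expR_ge0 // truncn_le expR_ge0.
  rewrite -expRM_natl ler_expR natrM.
  have := ler_wpM2l (ler0n R k) (sparsity_exponent_le d_ge2 eps01).
  by rewrite -/e; lra.
split.
  by apply: le_trans t_le; rewrite ler_nat rc_approx_rc_rigidity.
(* Each of the n rows has at most t^(2d) nonzero entries, with [d.+1] here for d. *)
apply: (@le_trans _ _ (n * (t ^ (2 * d.+1))%:R)).
  by rewrite -natrM ler_nat rc_approx_rigidity.
by rewrite [leRHS]powE mulrDl mul1r expRD expRM_natl lnK ?posrE // -nE -powE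
  ler_wpM2l // ltW.
Qed.
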